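(* Let $X,Y$ be Banach spaces and $T\colon X\to Y$ a bounded linear operator. Then the following inequalities hold: $$\tfrac14\operatorname{uc}(T)\le\operatorname{Rcc}(T)\le\operatorname{wcc}(T)\le\operatorname{wk}_Y(T),$$ $$\operatorname{Rcc}_\omega(T)\le\operatorname{wcc}_\omega(T)\le\omega(T),\qquad \operatorname{cc}_\rho(T)\le\operatorname{cc}(T)\le 4\chi(T),$$ $$\operatorname{Rcc}(T)\le\operatorname{Rcc}_\omega(T)\le\operatorname{cc}_\rho(T)\le 2\omega(T^* ),\qquad \operatorname{wcc}(T)\le\operatorname{wcc}_\omega(T)\le\operatorname{cc}(T),\qquad \operatorname{wk}_Y(T)\le\omega(T)\le\chi(T).$$
   Context: Scalars real or complex. For a bounded sequence $(y_n)$, $\operatorname{ca}((y_n))=\inf_{n}\sup\{\|y_k-y_l\|: k,l\geq n\}$. $\operatorname{uc}(T)=\sup\{\operatorname{ca}((\sum_{i=1}^n Tx_i)_n): (x_n)\subset X,\ \sup_{x^*\in B_{X^*}}\sum_n|x^*(x_n)|\le 1\}$. For a bounded subset $A$ of a Banach space $E$: $\chi(A)=\inf\{\sup_{a\in A}\operatorname{dist}(a,F): \emptyset\ne F\subset E\text{ finite}\}$; $\omega(A)=\inf\{\sup_{a\in A}\operatorname{dist}(a,K):\emptyset\ne K\subset E\text{ weakly compact}\}$; $\operatorname{wk}_E(A)=\sup\{\operatorname{dist}(x^{**},E): x^{**}\in\overline{A}^{w^*}\}$, where $\overline{A}^{w^*}$ is the weak$^*$ closure of $A$ in $E^{**}$.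 For the operator: $\chi(T)=\chi(T(B_X))$, $\omega(T)=\omega(T(B_X))$, $\operatorname{wk}_Y(T)=\operatorname{wk}_Y(T(B_X))$, $\omega(T^* )=\omega(T^*(B_{Y^*}))$ in $X^*$. The Right topology $\rho$ on a Banach space $X$ is the topology of uniform convergence on weakly compact subsets of $X^*$; a sequence is Right-Cauchy ($\rho$-Cauchy) if it is Cauchy in this topology. A weakly Cauchy sequence $(y_n)$ in $Y$ has a weak$^*$ limit in $Y^{**}$, denoted $w^*\text{-}\lim y_n$. Define $\operatorname{cc}(T)=\sup\{\operatorname{ca}((Tx_n)): (x_n)\text{ weakly Cauchy in }B_X\}$, $\operatorname{cc}_\rho(T)=\sup\{\operatorname{ca}((Tx_n)): (x_n)\ \rho\text{-Cauchy in }B_X\}$, $\operatorname{wcc}(T)=\sup\{\operatorname{dist}(w^*\text{-}\lim Tx_n,Y): (x_n)\text{ weakly Cauchy in }B_X\}$, $\operatorname{wcc}_\omega(T)=\sup\{\omega(\{Tx_n:n\in\mathbb N\}): (x_n)\text{ weakly Cauchy in }B_X\}$, $\operatorname{Rcc}(T)=\sup\{\operatorname{dist}(w^*\text{-}\lim Tx_n,Y): (x_n)\ \rho\text{-Cauchy in }B_X\}$, $\operatorname{Rcc}_\omega(T)=\sup\{\omega(\{Tx_n:n\in\mathbb N\}): (x_n)\ \rho\text{-Cauchy in }B_X\}$. *)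

(* Defs.v *)
From HB Require Import structures.
From mathcomp Require Import all_boot all_order all_algebra.
From mathcomp Require Import all_classical all_reals all_analysis.
From mathcomp Require Import complex.

Set Implicit Arguments.
Unset Strict Implicit.
Unset Printing Implicit Defensive.

Import Order.TTheory GRing.Theory Num.Theory.
Local Open Scope ring_scope.
Local Open Scope classical_set_scope.

Inductive scalar_kind := RealScalars | ComplexScalars.

Definition scal (R : realType) (sc : scalar_kind) : numFieldType :=
  match sc with RealScalars => R | ComplexScalars => (R[i] : numFieldType) end.

Definition smd (R : realType) (sc : scalar_kind) : scal R sc -> R :=
  match sc return scal R sc -> R with
  | RealScalars => fun z : R => `|z|
  | ComplexScalars => fun z : R[i] => complex.Re `|z|
  end.

(* Generic normed-space notions.  A "space" is given by an ambient lmodType *)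
(* V, its subset D of actual elements, and a norm N : V -> \bar R (finite  *)
(* on D).  This allows to treat X, X^{*} (functionals on X) and X^{**} uniformly.*)

Section Generic.
Variables (R : realType) (K : numFieldType) (md : K -> R).
Local Open Scope ereal_scope.

Section Space.
Variables (V : lmodType K) (D : set V) (N : V -> \bar R).

Definition dualD : set (V -> K^o) := fun f =>
  (forall (a : K) (u v : V), D u -> D v -> f (a *: u + v)%R = (a * f u + f v)%R) /\
  exists C : R, forall u, D u -> ((md (f u))%:E <= C%:E * N u).

Definition dualN (f : V -> K^o) : \bar R :=
  ereal_sup [set (md (f u))%:E | u in [set u | D u /\ N u <= 1]].

Definition vdist (x : V) (S : set V) : \bar R :=
  ereal_inf [set N (x - y)%R | y in S].

Definition weak_open (U : set V) : Prop :=
  U `<=` D /\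
  forall x, U x -> exists F : set (V -> K^o),
    [/\ F `<=` dualD, finite_set F &
      exists eps : R, (0 < eps)%R /\
        [set y | D y /\ forall f, F f -> (md (f y - f x) < eps)%R] `<=` U].

Definition weak_compact (C : set V) : Prop :=
  C `<=` D /\
  forall (I : Type) (U : I -> set V), (forall i, weak_open (U i)) ->
    C `<=` \bigcup_i U i ->
    exists J : set I, finite_set J /\ C `<=` \bigcup_(i in J) U i.

Definition chi (A : set V) : \bar R :=
  ereal_inf [set ereal_sup [set vdist a F | a in A]
            | F in [set F | [/\ F `<=` D, finite_set F & F !=set0]]].

Definition omega (A : set V) : \bar R :=
  ereal_inf [set ereal_sup [set vdist a C | a in A]
            | C in [set C | weak_compact C /\ C !=set0]].

Definition ca (y : nat -> V) : \bar R :=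
  ereal_inf (range (fun n : nat =>
    ereal_sup [set N (y k.1 - y k.2)%R
              | k in [set k : nat * nat | (n <= k.1)%N /\ (n <= k.2)%N]])).

End Space.

Section Bidual.
Variables (V : lmodType K) (D : set V) (N : V -> \bar R).

Definition bidualD : set ((V -> K^o) -> K^o) := @dualD (V -> K^o) (dualD D N) (dualN D N).
Definition bidualN : ((V -> K^o) -> K^o) -> \bar R := @dualN (V -> K^o) (dualD D N) (dualN D N).

Definition canJ (x : V) : (V -> K^o) -> K^o := fun f => f x.

Definition bidist (Phi : (V -> K^o) -> K^o) : \bar R :=
  @vdist ((V -> K^o) -> K^o) bidualN Phi (canJ @` D).

Definition wstar_closure (A : set V) : set ((V -> K^o) -> K^o) := fun Phi =>
  bidualD Phi /\
  forall F : set (V -> K^o), F `<=` dualD D N -> finite_set F ->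
  forall eps : R, (0 < eps)%R ->
    exists a, A a /\ forall f, F f -> (md (Phi f - f a) < eps)%R.

Definition wk (A : set V) : \bar R :=
  ereal_sup [set bidist Phi | Phi in wstar_closure A].

End Bidual.

Section Operators.
Variables (X Y : normedModType K).

Definition nrm (E : normedModType K) (x : E) : \bar R := (md `|x|)%:E.

Definition dual (E : normedModType K) : set (E -> K^o) :=
  @dualD E setT (@nrm E).
Definition dnorm (E : normedModType K) : (E -> K^o) -> \bar R :=
  @dualN E setT (@nrm E).

Definition ballX (E : normedModType K) : set E := [set x | (md `|x| <= 1)%R].
Definition ballXs (E : normedModType K) : set (E -> K^o) :=
  [set f | dual f /\ dnorm f <= 1].

Definition weakly_cauchy (E : normedModType K) (x : nat -> E) : Prop :=
  forall f, dual f -> forall eps : R, (0 < eps)%R ->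
    exists n0, forall n m, (n0 <= n)%N -> (n0 <= m)%N ->
      (md (f (x n) - f (x m)) < eps)%R.

(* Cauchy sequences for the Right topology: uniform convergence on weakly
   compact subsets of E^* (weak topology of E^{*}, i.e. sigma(E^{*}, E^{**})). *)
Definition rho_cauchy (E : normedModType K) (x : nat -> E) : Prop :=
  forall C, @weak_compact (E -> K^o) (@dual E) (@dnorm E) C ->
  forall eps : R, (0 < eps)%R ->
    exists n0, forall n m, (n0 <= n)%N -> (n0 <= m)%N ->
      forall f, C f -> (md (f (x n) - f (x m)) <= eps)%R.

Definition wstar_lim (E : normedModType K) (y : nat -> E)
    (Phi : (E -> K^o) -> K^o) : Prop :=
  @bidualD E setT (@nrm E) Phi /\
  forall f, dual f -> forall eps : R, (0 < eps)%R ->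
    exists n0, forall n, (n0 <= n)%N -> (md (f (y n) - Phi f) < eps)%R.

Definition bidistE (E : normedModType K) (Phi : (E -> K^o) -> K^o) : \bar R :=
  @bidist E setT (@nrm E) Phi.

Variable T : X -> Y.

Definition chiT : \bar R := @chi Y setT (@nrm Y) (T @` @ballX X).
Definition omegaT : \bar R := @omega Y setT (@nrm Y) (T @` @ballX X).
Definition wkT : \bar R := @wk Y setT (@nrm Y) (T @` @ballX X).
Definition omegaTs : \bar R :=
  @omega (X -> K^o) (@dual X) (@dnorm X) [set f \o T | f in @ballXs Y].

Definition ucT : \bar R :=
  ereal_sup [set @ca Y (@nrm Y) (fun n => (\sum_(i < n.+1) T (x i))%R)
            | x in [set x : nat -> X |
                ereal_sup [set \sum_(0 <= n <oo) (md (f (x n)))%:E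
                          | f in @ballXs X] <= 1]].

Definition ccT : \bar R :=
  ereal_sup [set @ca Y (@nrm Y) (T \o x)
            | x in [set x : nat -> X | weakly_cauchy x /\ forall n, @ballX X (x n)]].

Definition cc_rhoT : \bar R :=
  ereal_sup [set @ca Y (@nrm Y) (T \o x)
            | x in [set x : nat -> X | rho_cauchy x /\ forall n, @ballX X (x n)]].

Definition wccT : \bar R :=
  ereal_sup [set bidistE Phi | Phi in [set Phi | exists x : nat -> X,
     [/\ weakly_cauchy x, forall n, @ballX X (x n) & wstar_lim (T \o x) Phi]]].

Definition wcc_omegaT : \bar R :=
  ereal_sup [set @omega Y setT (@nrm Y) (range (T \o x))
            | x in [set x : nat -> X | weakly_cauchy x /\ forall n, @ballX X (x n)]].

Definition RccT : \bar R :=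
  ereal_sup [set bidistE Phi | Phi in [set Phi | exists x : nat -> X,
     [/\ rho_cauchy x, forall n, @ballX X (x n) & wstar_lim (T \o x) Phi]]].

Definition Rcc_omegaT : \bar R :=
  ereal_sup [set @omega Y setT (@nrm Y) (range (T \o x))
            | x in [set x : nat -> X | rho_cauchy x /\ forall n, @ballX X (x n)]].

End Operators.
End Generic.

(* Main.v *)
Require Import Defs.
From HB Require Import structures.
From mathcomp Require Import all_boot all_order all_algebra.
From mathcomp Require Import all_classical all_reals all_analysis.
From mathcomp Require Import complex lra ring.

(* The cheap inequalities come from three facts: a finite set is weakly
   compact, a w*-cluster point of a set within distance r of a weakly compact
   set C lies within r of some point of C, and beyond some index every term of a
   weakly Cauchy sequence is near centres (finitely many) that are pairwise
   close.  For uc(T) <= 4 Rcc(T), an oscillation larger than r of the partial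
   sums of (T x_i) gives disjoint blocks z_k with norming functionals g_k such
   that |g_k (T z_k)| > r.  A gliding hump, driven by a w*-cluster point of
   (g_k), makes the off-diagonal part of the matrix (g_k (T z_i)) at most r/4
   along a subsequence.  Then Phi = sum T z_k has |Phi g_k| >= 3r/4, whereas
   |Phi g| <= r/4 for each w*-cluster point g of (g_k), and so Phi is at
   distance at least r/4 from Y: on y in Y, g_k and g are frequently close.  The
   same argument, with weak cluster points in a weakly compact subset of X^*,
   shows that the partial sums of (z_k) are Right-Cauchy. *)

Set Implicit Arguments.
Unset Strict Implicit.
Unset Printing Implicit Defensive.

Import Order.TTheory GRing.Theory Num.Theory.
Import numFieldNormedType.Exports.
Local Open Scope ring_scope.
Local Open Scope classical_set_scope.

(** * Scalars *)

Section Scalars.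
Variables (R : realType) (sc : scalar_kind).
Implicit Types (z w : scal R sc) (r s : R).

(** Moduli and norms take values in the scalar field itself; transporting identities and
    inequalities along [emb] brings them back to [R], so that only a few proofs split on [sc]. *)
Definition emb : R -> scal R sc :=
  match sc return R -> scal R sc with
  | RealScalars => fun r => r
  | ComplexScalars => fun r => (r%:C)%C
  end.

Lemma norm_emb z : `|z| = emb (smd z).
Proof.
by rewrite /emb /smd; case: sc z => [z|z] //=; rewrite RRe_real ?normr_real.
Qed.

Lemma le_emb r s : (emb r <= emb s) = (r <= s).
Proof. by rewrite /emb; case: sc => //=; rewrite lecR. Qed.

Lemma emb_inj : injective emb.
Proof. by rewrite /emb => r s; case: sc => [|[]]. Qed.

Lemma emb0 : emb 0 = 0. Proof. by rewrite /emb; case: sc. Qed.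
Lemma emb1 : emb 1 = 1. Proof. by rewrite /emb; case: sc. Qed.

Lemma embD r s : emb (r + s) = emb r + emb s.
Proof. by rewrite /emb; case: sc => //=; rewrite rmorphD. Qed.

Lemma embM r s : emb (r * s) = emb r * emb s.
Proof. by rewrite /emb; case: sc => //=; rewrite rmorphM. Qed.

Lemma smd_ge0 z : 0 <= smd z.
Proof. by rewrite -le_emb emb0 -norm_emb. Qed.

Lemma smd_emb r : 0 <= r -> smd (emb r) = r.
Proof.
by move=> r0; apply: emb_inj; rewrite -norm_emb ger0_norm// -emb0 le_emb.
Qed.

Lemma smdM z w : smd (z * w) = smd z * smd w.
Proof. by apply: emb_inj; rewrite embM -!norm_emb normrM. Qed.

Lemma smdD z w : smd (z + w) <= smd z + smd w.
Proof. by rewrite -le_emb embD -!norm_emb ler_normD. Qed.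

Lemma smdN z : smd (- z) = smd z.
Proof. by apply: emb_inj; rewrite -!norm_emb normrN. Qed.

Lemma smd0 : smd (0 : scal R sc) = 0.
Proof. by apply: emb_inj; rewrite -norm_emb normr0 emb0. Qed.

Lemma smd_eq0 z : smd z = 0 -> z = 0.
Proof. by move=> z0; apply/eqP; rewrite -normr_eq0 norm_emb z0 emb0. Qed.

Lemma smd_distC z w : smd (z - w) = smd (w - z).
Proof. by rewrite -smdN opprB. Qed.

Lemma smd_distD w z z' : smd (z - z') <= smd (z - w) + smd (w - z').
Proof. by rewrite (le_trans _ (smdD _ _))// addrA subrK. Qed.

Lemma smd_distB z w : smd z - smd w <= smd (z - w).
Proof. by rewrite lerBlDr (le_trans _ (smdD _ _))// subrK. Qed.

Lemma smd_sum (I : Type) (s : seq I) (P : pred I) (F : I -> scal R sc) :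
  smd (\sum_(i <- s | P i) F i) <= \sum_(i <- s | P i) smd (F i).
Proof.
elim/big_rec2: _ => [|i y z _ yz]; first by rewrite smd0.
by rewrite (le_trans (smdD _ _))// lerD2l.
Qed.

Lemma smd_eq z w : (forall e, 0 < e -> smd (z - w) <= e) -> z = w.
Proof.
move=> zw; apply/eqP; rewrite -subr_eq0; apply/eqP/smd_eq0/eqP.
rewrite eq_le smd_ge0 andbT; apply/ler_addgt0Pr => e e0; rewrite add0r.
exact: zw.
Qed.

(** Used to pass linearity to a pointwise limit. Asking only for one approximating pair at each
    precision covers limits of sequences and limits along an ultrafilter alike. *)
Lemma linear_limit (a p q l : scal R sc) :
  (forall e, 0 < e -> exists u v,
    [/\ smd (a * u + v - l) < e, smd (u - p) < e & smd (v - q) < e]) ->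
  l = a * p + q.
Proof.
(* The three errors, the one at [u] multiplied by [a], add up to at most [(2 + smd a) * e'], which
   is [e]. *)
move=> h; apply: smd_eq => e e0; pose e' := e / (2 + smd a).
have a2 : 0 < 2 + smd a by rewrite ltr_wpDr ?smd_ge0.
have [|u [v [uvl up vq]]] := h e'; first by rewrite divr_gt0.
have := smd_distD (a * u + v) l (a * p + q); rewrite (smd_distC l (a * u + v)).
have -> : a * u + v - (a * p + q) = a * (u - p) + (v - q).
  by rewrite opprD addrACA mulrBr.
have := smdD (a * (u - p)) (v - q); rewrite smdM.
have : smd a * smd (u - p) <= smd a * e' by rewrite ler_wpM2l ?smd_ge0// ltW.
have -> : e = 2 * e' + smd a * e' by rewrite -mulrDl /e' mulrC divfK// gt_eqF.
lra.
Qed.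

Lemma smd_phase z : exists c, smd c <= 1 /\ c * z = emb (smd z).
Proof.
have [->|z0] := eqVneq z 0.
  by exists 0; rewrite smd0 mulr0 emb0; split => //; exact: ler01.
exists (`|z| / z); split; last by rewrite divfK// norm_emb.
rewrite -le_emb -norm_emb emb1 normrM normrV ?unitfE// normr_id divff//.
by rewrite normr_eq0.
Qed.

(** * Norms as real numbers *)

Definition fnorm (E : normedModType (scal R sc)) (x : E) : R := smd `|x|.

Section Norm.
Variable E : normedModType (scal R sc).
Implicit Types x y : E.

Lemma fnorm_emb x : `|x| = emb (fnorm x).
Proof. by rewrite /fnorm -norm_emb normr_id. Qed.

Lemma fnorm_ge0 x : 0 <= fnorm x. Proof. exact: smd_ge0. Qed.

Lemma fnorm0 : fnorm (0 : E) = 0.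
Proof. by rewrite /fnorm normr0 smd0. Qed.

Lemma fnorm0_eq0 x : fnorm x = 0 -> x = 0.
Proof. by move=> x0; apply/eqP; rewrite -normr_eq0 fnorm_emb x0 emb0. Qed.

Lemma fnormZ (a : scal R sc) x : fnorm (a *: x) = smd a * fnorm x.
Proof.
by apply: emb_inj; rewrite embM -!fnorm_emb normrZ norm_emb.
Qed.

Lemma fnormN x : fnorm (- x) = fnorm x.
Proof. by rewrite /fnorm normrN. Qed.

Lemma fnormD x y : fnorm (x + y) <= fnorm x + fnorm y.
Proof. by rewrite -le_emb embD -!fnorm_emb ler_normD. Qed.

Lemma fnorm_distC x y : fnorm (x - y) = fnorm (y - x).
Proof. by rewrite -fnormN opprB. Qed.

Lemma fnorm_distD y x x' : fnorm (x - x') <= fnorm (x - y) + fnorm (y - x').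
Proof. by rewrite (le_trans _ (fnormD _ _))// addrA subrK. Qed.

End Norm.

(** Compactness of [[-C, C]] gives the image of [U] a cluster point. It is a limit: otherwise the
    complement of a neighbourhood belongs to the ultrafilter, yet the cluster point forces it to
    meet that neighbourhood. *)
Lemma ultra_limit_real (U : set_system nat) (u : nat -> R) (C : R) :
  UltraFilter U -> (forall n, `|u n| <= C) ->
  exists l, forall e, 0 < e -> U [set n | `|u n - l| < e].
Proof.
move=> UU uC.
have [|l [_ lu]] := @segment_compact R (- C) C (u @ U) _.
  have Utop : U setT by exact: filterT.
  by apply: (filterS _ Utop : U (u @^-1` _)) => n _ /=; rewrite in_itv/= -ler_norml.
exists l => e e0.
have [//|Ue] := in_ultra_setVsetC [set n | `|u n - l| < e] UU.
have [_ [/= [n + <-]]] : (u @` (~` [set n | `|u n - l| < e])) `&` ball l e !=set0.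
  apply: lu; last exact: nbhsx_ballx.
  by apply: (filterS _ Ue : U (u @^-1` _)) => n nU; exists n.
by rewrite /ball/= distrC.
Qed.

Lemma ultra_limit (U : set_system nat) (u : nat -> scal R sc) (C : R) :
  UltraFilter U -> (forall n, smd (u n) <= C) ->
  exists l, forall e, 0 < e -> U [set n | smd (u n - l) < e].
Proof.
rewrite /smd; case: sc u => /= u UU uC; first exact: (ultra_limit_real UU uC).
have ReC n : `|complex.Re (u n)| <= C.
  apply: le_trans (uC n); case: (u n) => c d /=.
  by rewrite -sqrtr_sqr ler_sqrt ?lerDl ?addr_ge0 ?sqr_ge0.
have ImC n : `|complex.Im (u n)| <= C.
  apply: le_trans (uC n); case: (u n) => c d /=.
  by rewrite -sqrtr_sqr ler_sqrt ?lerDr ?addr_ge0 ?sqr_ge0.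
have [a ua] := ultra_limit_real UU ReC.
have [b ub] := ultra_limit_real UU ImC.
exists (a +i* b)%C => e e0; have e20 : 0 < e / 2 by rewrite divr_gt0.
apply: filterS (filterI (ua _ e20) (ub _ e20)) => n /= [].
case: (u n) => c d /= ca db.
rewrite -[ltRHS](@ger0_norm _ e) ?(ltW e0)// -sqrtr_sqr ltr_sqrt ?exprn_gt0//.
have sq x : `|x| < e / 2 -> x ^+ 2 < (e / 2) ^+ 2.
  by move=> xe; rewrite -real_normK ?num_real// ltr_pXn2r ?nnegrE ?(ltW e20).
move: (sq _ ca) (sq _ db).
have -> : e ^+ 2 = 4 * (e / 2) ^+ 2 by field.
have := sqr_ge0 (e / 2); lra.
Qed.

(** A limit along an ultrafilter that contains all tails exists by boundedness, and the Cauchy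
    condition makes it an ordinary limit. *)
Lemma cauchy_limit (u : nat -> scal R sc) :
  (forall e, 0 < e -> exists n0, forall n m, (n0 <= n)%N -> (n0 <= m)%N ->
    smd (u n - u m) <= e) ->
  exists l, forall e, 0 < e -> exists n0, forall n, (n0 <= n)%N -> smd (u n - l) < e.
Proof.
move=> uc; have [n1 n1P] := uc 1 ltr01.
have [U [UU oU]] := ultraFilterLemma eventually_filter.
have tail m : U [set n | (m <= n)%N] by apply: oU; exists m.
(* The shift by [n1] makes the whole sequence bounded, since all its terms are within 1 of
   [u n1]. *)
have [|l ul] := @ultra_limit U (fun n => u (n1 + n)%N) (smd (u n1) + 1) UU.
  move=> n; rewrite -lerBlDl (le_trans (smd_distB _ _))//.
  by rewrite n1P ?leq_addr.
exists l => e e0; have e30 : 0 < e / 3 by rewrite divr_gt0.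
have [n0 n0P] := uc _ e30; exists n0 => n n0n.
have [m [/= mn0 um]] := filter_ex (filterI (tail n0) (ul _ e30)).
rewrite (le_lt_trans (smd_distD (u (n1 + m)%N) _ _))//.
have := n0P n (n1 + m)%N n0n (leq_trans mn0 (leq_addl _ _)).
lra.
Qed.

End Scalars.

(** * Algebra of linear forms *)

Section LinearForm.
Variables (R : realType) (sc : scalar_kind) (E : lmodType (scal R sc)).
Variable f : E -> (scal R sc)^o.
Hypothesis fL : forall a u v, f (a *: u + v) = a * f u + f v.

Lemma linform0 : f 0 = 0.
Proof.
by have /eqP := fL 1 0 0; rewrite scaler0 addr0 mul1r -subr_eq subrr eq_sym => /eqP.
Qed.

Lemma linformD u v : f (u + v) = f u + f v.
Proof. by have := fL 1 u v; rewrite scale1r mul1r. Qed.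

Lemma linformZ a u : f (a *: u) = a * f u.
Proof. by have := fL a u 0; rewrite linform0 !addr0. Qed.

Lemma linformN u : f (- u) = - f u.
Proof. by rewrite -scaleN1r linformZ mulN1r. Qed.

Lemma linformB u v : f (u - v) = f u - f v.
Proof. by rewrite linformD linformN. Qed.

Lemma linform_sum (x : nat -> E) a b :
  f (\sum_(a <= i < b) x i) = \sum_(a <= i < b) f (x i).
Proof.
elim/big_rec2: _ => [|i y1 y2 _ IH]; first exact: linform0.
by rewrite linformD IH.
Qed.

End LinearForm.

(** * The Hahn-Banach theorem *)

Section HahnBanach.
Variables (R : realType) (sc : scalar_kind) (V : lmodType (scal R sc)).
Implicit Types (p : V -> R) (u v x : V) (r s t : R).

(** Homogeneity concerns non-negative reals only: a complex space is treated here as a real one. *)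
Definition sublinear p :=
  (forall u v, p (u + v) <= p u + p v) /\
  (forall r u, 0 <= r -> p (emb sc r *: u) = r * p u).

Lemma sublinear0 p : sublinear p -> p 0 = 0.
Proof. by case=> _ /(_ 0 0 (lexx 0)); rewrite scaler0 mul0r. Qed.

Lemma sublinear_ge_opp p u : sublinear p -> - p (- u) <= p u.
Proof.
move=> ps; rewrite -subr_ge0 opprK -(sublinear0 ps) -(subrr u).
exact: ps.1.
Qed.

(* The sublinear minorant of [p] that is linear on the line through [x]. *)
Definition flatten p x v := 
  inf [set p (v + emb sc t *: x) - t * p x | t in [set t | 0 <= t]].

Lemma flatten_lb p x v : sublinear p ->
  lbound [set p (v + emb sc t *: x) - t * p x | t in [set t | 0 <= t]] (- p (- v)).
Proof.
move=> ps _ [t /= t0 <-]; rewrite -ps.2//.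
have := ps.1 (- v) (v + emb sc t *: x); rewrite addKr; lra.
Qed.

Lemma flatten_le p x v t : sublinear p -> 0 <= t ->
  flatten p x v <= p (v + emb sc t *: x) - t * p x.
Proof.
move=> ps t0; apply: ge_inf; first by exists (- p (- v)); exact: flatten_lb.
by exists t.
Qed.

Lemma flatten_ge p x v c :
  (forall t, 0 <= t -> c <= p (v + emb sc t *: x) - t * p x) -> c <= flatten p x v.
Proof.
move=> cp; apply: lb_le_inf.
  by exists (p (v + emb sc 0 *: x) - 0 * p x); exists 0 => /=.
by move=> _ [t /= t0 <-]; exact: cp.
Qed.

Lemma flatten_le_id p x v : sublinear p -> flatten p x v <= p v.
Proof.
by move=> ps; have := flatten_le x v ps (lexx 0); rewrite emb0 scale0r addr0 mul0r subr0.
Qed.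

(** Subadditivity adds the parameters of the two infima. Homogeneity rescales the parameter by [r],
    so [r = 0] is treated apart. *)
Lemma flatten_sublinear p x : sublinear p -> sublinear (flatten p x).
Proof.
move=> ps; split=> [u v|r u].
- rewrite -lerBlDr; apply: flatten_ge => t t0.
  rewrite lerBlDr -lerBlDl; apply: flatten_ge => s s0.
  rewrite lerBlDl; apply: (le_trans (flatten_le _ _ ps (addr_ge0 t0 s0))).
  have := ps.1 (u + emb sc t *: x) (v + emb sc s *: x).
  rewrite addrACA -scalerDl -embD mulrDl; lra.
rewrite le_eqVlt => /predU1P[<-|r0].
  rewrite emb0 scale0r mul0r; apply/eqP; rewrite eq_le; apply/andP; split.
    by rewrite -[leRHS](sublinear0 ps) flatten_le_id.
  by apply: flatten_ge => t t0; rewrite add0r ps.2// subrr.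
apply/eqP; rewrite eq_le; apply/andP; split.
  rewrite mulrC -ler_pdivrMr//; apply: flatten_ge => t t0.
  rewrite ler_pdivrMr// mulrC mulrBr -(ps.2 r _ (ltW r0)) scalerDr scalerA -embM mulrA.
  by apply: flatten_le; rewrite ?mulr_ge0// ltW.
apply: flatten_ge => t t0.
have rt : r * (t / r) = t by rewrite mulrCA divff ?mulr1// gt_eqF.
have := flatten_le x u ps (divr_ge0 t0 (ltW r0)).
by rewrite -(ler_pM2l r0) mulrBr -(ps.2 r _ (ltW r0)) scalerDr scalerA -embM rt mulrA rt.
Qed.

(* Zorn on the sublinear functionals below [p]: a minimal one equals all its
   flattenings, hence is additive. *)
Lemma hahn_banach_sublinear p : sublinear p -> exists g : V -> R,
  [/\ sublinear g, forall u v, g (u + v) = g u + g v & forall v, g v <= p v].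
Proof.
move=> ps.
pose T := {q : V -> R | sublinear q /\ forall v, q v <= p v}.
(* The order is reversed, so that a maximal element in Zorn's lemma is a minimal functional. *)
pose le_ (q1 q2 : T) := `[< forall v, sval q2 v <= sval q1 v >].
have lerefl (q : T) : le_ q q by apply/asboolP.
have letrans (q1 q2 q3 : T) : le_ q1 q2 -> le_ q2 q3 -> le_ q1 q3.
  by move=> /asboolP rs /asboolP st; apply/asboolP => v; exact: le_trans (st v) (rs v).
have leanti (q1 q2 : T) : le_ q1 q2 -> le_ q2 q1 -> q1 = q2.
  case: q1 q2 => [q1 h1] [q2 h2] /asboolP /= st /asboolP /= ts.
  have q12 : q1 = q2 by apply/funext => v; apply/eqP; rewrite eq_le st ts.
  by subst q2; congr exist; exact: Prop_irrelevance.
have [A Atot|[g [gs gp]] gmin] := Zorn lerefl letrans leanti.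
  have [[q0 Aq0]|A0] := pselect (exists q, A q); last first.
    by exists (exist _ p (conj ps (fun v => lexx _))) => s As; case: A0; exists s.
  pose S v := [set sval q v | q in A].
  have Slb v : has_lbound (S v).
    exists (- p (- v)) => _ [q Aq <-]; case: q Aq => q [qs qp] /= _.
    by rewrite (le_trans _ (sublinear_ge_opp _ qs))// lerN2.
  have Snz v : S v !=set0 by exists (sval q0 v); exists q0.
  pose m v := inf (S v).
  have mle (q : T) v : A q -> m v <= sval q v by move=> Aq; apply: ge_inf => //; exists q.
  have ms : sublinear m.
    split=> [u v|r u r0].
      rewrite -lerBlDr; apply: lb_le_inf => // _ [q Aq <-].
      rewrite lerBlDr -lerBlDl; apply: lb_le_inf => // _ [q' Aq' <-].
      rewrite lerBlDl.
      (* The smaller of the two members of the chain bounds the infimum at [u + v]. *)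
      have [/asboolP qq'|/asboolP qq'] := Atot q q' Aq Aq'.
        by rewrite (le_trans (mle q' _ Aq'))// (le_trans ((svalP q').1.1 _ _))// lerD2r.
      by rewrite (le_trans (mle q _ Aq))// (le_trans ((svalP q).1.1 _ _))// lerD2l.
    move: r0; rewrite le_eqVlt => /predU1P[<-|r0].
      rewrite emb0 scale0r mul0r; apply/eqP; rewrite eq_le; apply/andP; split.
        by rewrite -[leRHS](sublinear0 (svalP q0).1) mle.
      by apply: lb_le_inf => // _ [q Aq <-]; rewrite (sublinear0 (svalP q).1).
    apply/eqP; rewrite eq_le; apply/andP; split.
      rewrite mulrC -ler_pdivrMr//; apply: lb_le_inf => // _ [q Aq <-].
      by rewrite ler_pdivrMr// mulrC -((svalP q).1.2 _ _ (ltW r0)) mle.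
    apply: lb_le_inf => // _ [q Aq <-].
    by rewrite ((svalP q).1.2 _ _ (ltW r0)) ler_pM2l// mle.
  have mp v : m v <= p v by rewrite (le_trans (mle q0 _ Aq0))// (svalP q0).2.
  by exists (exist _ m (conj ms mp)) => q Aq; apply/asboolP => v; exact: mle.
exists g; split=> // u v; apply/eqP; rewrite eq_le gs.1 /=.
have fp w : flatten g v w <= p w by rewrite (le_trans (flatten_le_id v w gs)).
have /(congr1 sval)/= fg := gmin
  (exist _ (flatten g v) (conj (flatten_sublinear v gs) fp))
  (asboolT (flatten_le_id v ^~ gs)).
have := flatten_le v u gs ler01; rewrite fg emb1 scale1r mul1r; lra.
Qed.

(** Applying the previous lemma below [flatten p x] rather than [p] gives [g (- x) <= p 0 - p x],
    hence [g x >= p x]. Additivity extends homogeneity to negative scalars. *)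
Lemma hahn_banach_real p x : sublinear p -> exists g : V -> R,
  [/\ forall r u v, g (emb sc r *: u + v) = r * g u + g v,
      forall v, g v <= p v & g x = p x].
Proof.
move=> ps; have [g [gs gD gp]] := hahn_banach_sublinear (flatten_sublinear x ps).
have gN v : g (- v) = - g v.
  by apply/eqP; rewrite -addr_eq0 -gD addNr (sublinear0 gs).
have gZ r u : g (emb sc r *: u) = r * g u.
  have [r0|r0] := leP 0 r; first exact: gs.2.
  have -> : emb sc r = - emb sc (- r).
    by apply/eqP; rewrite -addr_eq0 -embD subrr emb0.
  by rewrite scaleNr gN gs.2 ?mulNr ?opprK// oppr_ge0 ltW.
exists g; split=> [r u v|v|]; first by rewrite gD gZ.
  by rewrite (le_trans (gp v))// flatten_le_id.
apply/eqP; rewrite eq_le (le_trans (gp x))/= ?flatten_le_id//.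
have := le_trans (gp (- x)) (flatten_le x (- x) ps ler01).
by rewrite gN emb1 scale1r addNr (sublinear0 ps) mul1r sub0r lerN2.
Qed.

End HahnBanach.

Lemma norming_functional (R : realType) (sc : scalar_kind)
    (E : normedModType (scal R sc)) (x : E) : exists f : E -> (scal R sc)^o,
  [/\ forall a u v, f (a *: u + v) = a * f u + f v,
      forall u, smd (f u) <= fnorm u & smd (f x) = fnorm x].
Proof.
have ns : sublinear (@fnorm R sc E).
  split=> [u v|r u r0]; first exact: fnormD.
  by rewrite fnormZ smd_emb.
have [g [gl gn gx]] := hahn_banach_real x ns.
(* It is enough to have a scalar-linear [f] with real part [g], stated without mentioning real
   parts. A phase [c] then makes [f (c *: u)] equal to the modulus of [f u], which is [g (c *: u)]
   and so at most the norm of [u]. *)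
suff [f [fl fg]] : exists f : E -> (scal R sc)^o,
    (forall a u v, f (a *: u + v) = a * f u + f v) /\
    (forall u, g u <= smd (f u) /\ (f u = emb sc (smd (f u)) -> g u = smd (f u))).
  have fn u : smd (f u) <= fnorm u.
    have [c [c1 cf]] := smd_phase (f u).
    have f0 := linform0 fl.
    have fcu : f (c *: u) = emb sc (smd (f u)) by rewrite -cf -[c *: u]addr0 fl f0 addr0.
    have := (fg (c *: u)).2; rewrite fcu smd_emb ?smd_ge0// => /(_ erefl) <-.
    by rewrite (le_trans (gn _))// fnormZ ler_piMl ?fnorm_ge0.
  exists f; split=> //; apply/eqP; rewrite eq_le fn/= -gx; exact: (fg x).1.
rewrite /smd /emb; clear ns gx gn x; case: sc E g gl => /= E g gl.
  exists g; split=> // u; split=> //; exact: ler_norm.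
have g0 : g 0 = 0.
  by have /eqP := gl 1 0 0; rewrite scaler0 addr0 mul1r -subr_eq subrr eq_sym => /eqP.
have gD u v : g (u + v) = g u + g v by have := gl 1 u v; rewrite scale1r mul1r.
have gZ r u : g (r%:C%C *: u) = r * g u by have := gl r u 0; rewrite g0 !addr0.
have gN u : g (- u) = - g u by apply/eqP; rewrite -addr_eq0 -gD addNr g0.
(* The usual complexification of a real functional, [g u - i g(iu)]. *)
exists (fun u => (g u +i* - g ('i%C *: u))%C); split.
  move=> [a b] u v.
  have abE w : (a +i* b)%C *: w = a%:C%C *: w + b%:C%C *: ('i%C *: w).
    by rewrite scalerA -scalerDl; congr (_ *: _); simpc.
  have iabE w : 'i%C *: ((a +i* b)%C *: w) = a%:C%C *: ('i%C *: w) - b%:C%C *: w.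
    rewrite !scalerA -scalerBl; congr (_ *: _); by simpc.
  rewrite /= scalerDr !gD iabE abE !gD gN !gZ; simpc.
  congr (_ +i* _)%C; ring.
move=> u; split => /=; last by case.
by rewrite (le_trans (ler_norm _))// -sqrtr_sqr ler_sqrt ?lerDl ?addr_ge0 ?sqr_ge0.
Qed.

(** * Gliding humps *)

Section Sums.
Variable R : realType.
Implicit Types (F : nat -> R) (e : R).

Definition bounded_sums F := exists C, forall n, \sum_(0 <= i < n) F i <= C.

Lemma bounded_sums_tail F e : (forall i, 0 <= F i) -> bounded_sums F -> 0 < e ->
  exists N, forall a b, (N <= a)%N -> \sum_(a <= i < b) F i <= e.
Proof.
move=> F0 [C FC] e0.
have hs : has_sup (range (fun n => \sum_(0 <= i < n) F i)).
  by split; [exists (\sum_(0 <= i < 0) F i); exists 0%N|exists C => _ [n _ <-]].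
have [_ [N _ <-] NS] := sup_adherent e0 hs.
exists N => a b Na; have [ab|/ltnW ba] := leqP a b; last by rewrite big_geq// ltW.
have : \sum_(0 <= i < b) F i <= sup (range (fun n => \sum_(0 <= i < n) F i)).
  by apply: ub_le_sup; [exists C => _ [n _ <-]|exists b].
rewrite (@big_cat_nat _ _ _ a)//= (@big_cat_nat _ _ _ N 0 a)//=.
have : 0 <= \sum_(N <= i < a) F i by apply: sumr_ge0.
lra.
Qed.

Lemma leq_increasing (s : nat -> nat) : (forall j, s j < s j.+1)%N ->
  forall i j, (i <= j)%N -> (s i <= s j)%N.
Proof.
move=> sS i j ij; rewrite -(subnKC ij).
elim: (j - i)%N => [|k IH]; first by rewrite addn0.
by rewrite addnS (leq_trans IH)// ltnW.
Qed.

Lemma sum_increasing F (s : nat -> nat) a b : (forall i, 0 <= F i) ->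
  (forall j, s j < s j.+1)%N ->
  \sum_(a <= i < b) F (s i) <= \sum_(s a <= k < s b) F k.
Proof.
move=> F0 sS; have [ab|ba] := leqP a b; last first.
  by rewrite big_geq ?(ltnW ba)// sumr_ge0.
rewrite -(subnKC ab); elim: (b - a)%N => [|k IH].
  by rewrite addn0 big_geq// sumr_ge0.
rewrite addnS big_nat_recr ?leq_addr//=.
have aak : (s a <= s (a + k))%N by apply: leq_increasing => //; rewrite leq_addr.
rewrite (@big_cat_nat _ _ _ (s (a + k)%N) (s a) (s (a + k).+1))//= ?(ltnW (sS _))//.
rewrite lerD//.
by rewrite big_ltn// lerDl sumr_ge0.
Qed.

(** Each new index lies beyond the point where the tail of the previous row is at most [e], which
    controls the entries to the right of the diagonal. Its row is also dominated by [b], up to a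
    small error, on all columns chosen so far, which controls those to the left. *)
Lemma gliding_hump (a : nat -> nat -> R) (b : nat -> R) e :
  (forall k i, 0 <= a k i) -> (forall k, bounded_sums (a k)) ->
  (forall i, 0 <= b i) -> bounded_sums b -> 0 < e ->
  (forall N m d, 0 < d ->
    exists k, (m <= k)%N /\ forall i, (i < N)%N -> a k i <= b i + d) ->
  exists s : nat -> nat, [/\ forall j, (s j < s j.+1)%N,
    forall j n, (n <= j)%N -> \sum_(0 <= i < n) a (s j) (s i) <= e &
    forall j n, \sum_(j.+1 <= i < n) a (s j) (s i) <= e].
Proof.
move=> a0 asum b0 bsum e0 ab.
have e20 : 0 < e / 2 by rewrite divr_gt0.
have [B Bb] := bounded_sums_tail b0 bsum e20.
have [t ta] := choice (fun k => bounded_sums_tail (a0 k) (asum k) e0).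
have /choice[f fP] n : exists k, [/\ (n < k)%N, (t n <= k)%N &
    forall i, (i <= n)%N -> a k i <= b i + (e / 2) / n.+1%:R].
  have [|k [mk ka]] := ab n.+1 (maxn n.+1 (t n)) ((e / 2) / n.+1%:R).
    by rewrite divr_gt0.
  by exists k; split=> //; apply: leq_trans mk; rewrite (leq_maxl, leq_maxr).
(* Starting at [B] keeps the contribution of [b] at most [e / 2]. In row [s j.+1] at most [j.+1]
   errors of size [(e / 2) / (s j).+1] occur, and [j <= s j], so they add at most another
   [e / 2]. *)
pose s j := iter j f B.
have sS j : (s j < s j.+1)%N by have [] := fP (s j).
have sj j : (j <= s j)%N by elim: j => // j IH; exact: leq_ltn_trans IH (sS _).
exists s; split=> // [[|j] n nj|j n].
- by move: nj; rewrite leqn0 => /eqP ->; rewrite big_geq// ltW.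
- apply: (@le_trans _ _ (\sum_(0 <= i < n) (b (s i) + e / 2 / (s j).+1%:R))).
    rewrite big_nat [leRHS]big_nat; apply: ler_sum => i /= ilt.
    have [_ _] := fP (s j); apply; apply: leq_increasing => //.
    by rewrite -ltnS (leq_trans ilt).
  rewrite big_split/= sumr_const_nat subn0.
  have : \sum_(0 <= i < n) b (s i) <= e / 2.
    by rewrite (le_trans (sum_increasing _ _ b0 sS))// Bb.
  have : (e / 2) / (s j).+1%:R *+ n <= e / 2.
    rewrite -mulr_natr -mulrA ler_piMr ?(ltW e20)// mulrC ler_pdivrMr// mul1r ler_nat.
    by rewrite (leq_trans nj)// ltnS sj.
  by move=> h1 h2; rewrite [leRHS](splitr e) lerD.
- rewrite (le_trans (sum_increasing _ _ (a0 _) sS))// ta//.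
  by have [] := fP (s j).
Qed.

Lemma disjoint_blocks (P : nat -> nat -> Prop) :
  (forall N, exists l u, [/\ (N <= l)%N, (l <= u)%N & P l u]) ->
  exists l u : nat -> nat,
    [/\ forall k, (l k <= u k)%N, forall k, (u k <= l k.+1)%N & forall k, P (l k) (u k)].
Proof.
move=> hP; have /choice[f fP] N : exists p : nat * nat,
    [/\ (N <= p.1)%N, (p.1 <= p.2)%N & P p.1 p.2].
  by have [l [u ?]] := hP N; exists (l, u).
pose p k := iter k (fun q => f q.2) (f 0%N).
exists (fun k => (p k).1), (fun k => (p k).2); split.
- by case=> [|k]; [have [] := fP 0%N|have [] := fP (p k).2].
- by move=> k; have [] := fP (p k).2.
- by case=> [|k]; [have [] := fP 0%N|have [] := fP (p k).2].
Qed.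

Lemma sum_blocks F (l u : nat -> nat) n : (forall i, 0 <= F i) ->
  (forall k, (l k <= u k)%N) -> (forall k, (u k <= l k.+1)%N) ->
  \sum_(0 <= k < n) \sum_(l k <= i < u k) F i <= \sum_(0 <= i < l n) F i.
Proof.
move=> F0 lu ul; elim: n => [|n IH]; first by rewrite big_geq// sumr_ge0.
rewrite big_nat_recr//= (@big_cat_nat _ _ _ (l n) 0 (l n.+1))//=; last first.
  exact: leq_trans (lu _) (ul _).
rewrite lerD// (@big_cat_nat _ _ _ (u n) (l n) (l n.+1))//= lerDl sumr_ge0//.
Qed.

End Sums.

(** * Weakly compact sets *)

(** For [x] an infimum, a real [r] strictly above it provides a witness of value below [r]; infinite
    values are dealt with once, here. *)
Lemma le_ereal_upper (R : realType) (x y : \bar R) :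
  (forall r : R, (x < r%:E)%E -> (y <= r%:E)%E) -> (y <= x)%E.
Proof.
move=> h; have [/eqP->|xoo] := boolP (x == +oo%E); first exact: leey.
apply/lee_addgt0Pr => e e0; case: x h xoo => [r|//|] h _.
  by apply: h; rewrite lte_fin ltrDl.
rewrite addNye leeNy_eq; case: y h => [s|/(_ 0)|] h //; last first.
  by have := h (ltNyr _).
by have := h (s - 1) (ltNyr _); rewrite lee_fin; lra.
Qed.

Lemma finite_eventually (T : Type) (F : set T) (P : T -> nat -> Prop) :
  finite_set F ->
  (forall x, F x -> exists n0, forall n, (n0 <= n)%N -> P x n) ->
  exists n0, forall n, (n0 <= n)%N -> forall x, F x -> P x n.
Proof.
(* A choice structure is put on [T] so that the finite set can be enumerated by a sequence. *)
elim/Pchoice: T F P => T F P /finite_seqP[s ->{F}].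
elim: s => [_|x s IH h]; first by exists 0%N.
have [n1 h1] := IH (fun y ys => h y (mem_behead (ys : y \in behead (x :: s)))).
have [n2 h2] := h x (mem_head _ _).
exists (maxn n1 n2) => n; rewrite geq_max => /andP[n1n n2n] y.
by rewrite /= inE => /predU1P[->|ys]; [exact: h2|exact: h1].
Qed.

Section WeakCompact.
Variables (R : realType) (sc : scalar_kind).
Let K := scal R sc.
Variables (V : lmodType K) (D : set V) (N : V -> \bar R).
Let md := @smd R sc.

Lemma weak_open_ball (Psi : V -> K^o) (c : K) (r : R) : dualD md D N Psi ->
  weak_open md D N [set v | D v /\ r < smd (c - Psi v)].
Proof.
move=> dPsi; split=> [v []//|v [Dv rv]]; exists [set Psi]; split.
- by move=> _ ->.
- exact: finite_set1.
- exists (smd (c - Psi v) - r); rewrite subr_gt0; split=> // w [Dw /(_ _ erefl) vw].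
  split=> //; have := smd_distD (Psi w) c (Psi v); rewrite /md in vw; lra.
Qed.

Lemma weak_compact_finite (C : set V) : C `<=` D -> finite_set C -> weak_compact md D N C.
Proof.
move=> CD fC; split=> // I U Uo CU.
(* A point of [C] supplies a default index [i0], used to make the choice of indices total. *)
have [[c0 Cc0]|C0] := pselect (C !=set0); last first.
  by exists set0; split; [exact: finite_set0|move=> c Cc; case: C0; exists c].
have [i0 _ _] := CU _ Cc0.
have /choice[g gP] c : exists i, C c -> U i c.
  have [/CU[i _ Ui]|nC] := pselect (C c); first by exists i.
  by exists i0.
exists (g @` C); split; first exact: finite_image.
by move=> c Cc; exists (g c); [exists c|exact: gP].
Qed.

(* [U m] is the complement of the weak closure of the tail [f k], [k >= m]. *)
Lemma weak_compact_cluster (C : set V) (f : nat -> V) :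
  weak_compact md D N C -> (forall k, C (f k)) ->
  exists h, C h /\ forall F, F `<=` dualD md D N -> finite_set F ->
    forall (e : R) m, 0 < e ->
    exists k, (m <= k)%N /\ forall Psi, F Psi -> smd (Psi (f k) - Psi h) < e.
Proof.
move=> [CD Ccov] Cf; apply: contrapT => nocl.
pose sep m h (F : set (V -> K^o)) (e : R) :=
  [/\ F `<=` dualD md D N, finite_set F, 0 < e &
  forall k, (m <= k)%N -> ~ forall Psi, F Psi -> smd (Psi (f k) - Psi h) < e].
pose U m := [set h | D h /\ exists F e, sep m h F e].
have Uo m : weak_open md D N (U m).
  split=> [h []//|h [Dh [F [e [FD fF e0 Fk]]]]].
  (* Points within [e / 2] of [h] on [F] are still separated from the tail, with margin [e / 2]. *)
  exists F; split=> //; exists (e / 2); rewrite divr_gt0//; split=> // h' [Dh' hh'].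
  split=> //; exists F, (e / 2); split; rewrite ?divr_gt0// => k mk Fk'.
  apply: (Fk k mk) => Psi FPsi; rewrite (le_lt_trans (smd_distD (Psi h') _ _))//.
  by rewrite (splitr e) ltrD// ?Fk'//; exact: hh'.
have CU : C `<=` \bigcup_m U m.
  move=> h Ch; apply: contrapT => nU; apply: nocl; exists h; split=> // F FD fF e m e0.
  apply: contrapT => nk; apply: nU; exists m => //; split; first exact: CD.
  by exists F, e; split=> // k mk hk; apply: nk; exists k.
have [J [fJ CJ]] := Ccov _ _ Uo CU.
(* Some [U m] with [m <= M] contains [f M], which would separate [f M] from a tail to which it
   belongs. *)
have [M MP] : exists M, forall m, J m -> (m <= M)%N.
  have [//|m _|M MP] := @finite_eventually _ J (fun m n => (m <= n)%N); first by exists m.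
  by exists M; exact: MP.
have [m Jm [_ [F [e [FD fF e0 Fk]]]]] := CJ _ (Cf M).
by apply: (Fk M (MP _ Jm)) => Psi _; rewrite subrr smd0.
Qed.

End WeakCompact.

(** * Duals and biduals *)

Section Dual.
Variables (R : realType) (sc : scalar_kind) (E : normedModType (scal R sc)).
Local Notation md := (@smd R sc).
Implicit Types (f g : E -> (scal R sc)^o) (Phi : (E -> (scal R sc)^o) -> (scal R sc)^o).

Lemma dualP f : dual md f <->
  (forall a u v, f (a *: u + v) = a * f u + f v) /\
  exists C, forall u, smd (f u) <= C * fnorm u.
Proof.
split=> [[fL [C fC]]|[fL [C fC]]]; split.
- by move=> a u v; exact: fL.
- by exists C => u; have := fC u I; rewrite lee_fin.
- by move=> a u v _ _; exact: fL.
- by exists C => u _; rewrite lee_fin fC.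
Qed.

Lemma dual_linear f : dual md f -> forall a u v, f (a *: u + v) = a * f u + f v.
Proof. by case/dualP. Qed.

Lemma dnorm_leP f (r : R) : dual md f -> (dnorm md f <= r%:E)%E <->
  0 <= r /\ forall u, smd (f u) <= r * fnorm u.
Proof.
move=> /dualP[fL _]; split=> [fr|[r0 fr]]; last first.
  apply: ge_ereal_sup => _ [u [_ +] <-]; rewrite !lee_fin -/(fnorm u) => u1.
  by rewrite (le_trans (fr u))// ler_piMr.
have fr1 u : fnorm u <= 1 -> smd (f u) <= r.
  move=> u1; rewrite -lee_fin (le_trans _ fr)//; apply: ereal_sup_ubound.
  by exists u => //; split => //; rewrite lee_fin.
have r0 : 0 <= r by rewrite -[0](smd0 R sc) -(linform0 fL) fr1 ?fnorm0.
split=> // u; have [u0|u0] := eqVneq (fnorm u) 0.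
  by rewrite (fnorm0_eq0 u0) (linform0 fL) smd0 fnorm0 mulr0.
have upos : 0 < fnorm u by rewrite lt_neqAle eq_sym u0 fnorm_ge0.
have := fr1 (emb sc (fnorm u)^-1 *: u).
rewrite fnormZ smd_emb ?invr_ge0 ?fnorm_ge0// mulVf// => /(_ (lexx _)).
rewrite (linformZ fL) smdM smd_emb ?invr_ge0 ?fnorm_ge0//.
by rewrite ler_pdivrMl// mulrC.
Qed.

Lemma dnorm_ge0 f : dual md f -> (0 <= dnorm md f)%E.
Proof.
move=> /dual_linear fL; apply: ereal_sup_ubound.
by exists 0; [split=> //; rewrite lee_fin -/(fnorm 0) fnorm0|rewrite (linform0 fL) smd0].
Qed.

Lemma dnormP f : dual md f -> exists c : R, [/\ 0 <= c, dnorm md f = c%:E &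
  forall u, smd (f u) <= c * fnorm u].
Proof.
move=> df; have [fL [C fC]] := (dualP f).1 df.
have fC' : (dnorm md f <= (`|C|)%:E)%E.
  apply/dnorm_leP => //; split=> // u; rewrite (le_trans (fC u))//.
  by rewrite ler_wpM2r ?fnorm_ge0// ler_norm.
have ffin : dnorm md f \is a fin_num.
  by rewrite ge0_fin_numE ?dnorm_ge0// (le_lt_trans fC')// ltry.
exists (fine (dnorm md f)); rewrite fineK//.
have : (dnorm md f <= (fine (dnorm md f))%:E)%E by rewrite fineK.
by move=> /(dnorm_leP _ df)[? ?]; split.
Qed.

Lemma ballXsP f : ballXs md f <->
  (forall a u v, f (a *: u + v) = a * f u + f v) /\ forall u, smd (f u) <= fnorm u.
Proof.
split=> [[df /(dnorm_leP _ df)[_ f1]]|[fL f1]].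
  by split=> [|u]; [exact: dual_linear|have := f1 u; rewrite mul1r].
have df : dual md f by apply/dualP; split=> //; exists 1 => u; rewrite mul1r.
by split=> //; apply/(dnorm_leP _ df); split=> // u; rewrite mul1r.
Qed.

Lemma norming (x : E) : exists2 f, ballXs md f & smd (f x) = fnorm x.
Proof. by have [f [fL f1 fx]] := norming_functional x; exists f => //; apply/ballXsP. Qed.

Lemma fnorm_le_dual (x : E) (r : R) : (forall f, ballXs md f -> smd (f x) <= r) ->
  fnorm x <= r.
Proof. by move=> h; have [f f1 <-] := norming x; exact: h. Qed.

Lemma canJ_bidual x : bidualD md setT (@nrm _ _ md E) (canJ x).
Proof.
split=> //.
exists (fnorm x) => f df; have [c [c0 fE fc]] := dnormP df.
by rewrite -/(dnorm md f) fE -EFinM lee_fin mulrC /canJ fc.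
Qed.

Lemma bidualN_leP Phi (r : R) :
  (bidualN md setT (@nrm _ _ md E) Phi <= r%:E)%E <->
  forall f, ballXs md f -> smd (Phi f) <= r.
Proof.
split=> [h f f1|h].
  rewrite -lee_fin (le_trans _ h)//; apply: ereal_sup_ubound.
  by exists f.
by apply: ge_ereal_sup => _ [f f1 <-]; rewrite lee_fin; exact: h.
Qed.

Lemma bidist_le Phi x (r : R) :
  (forall f, ballXs md f -> smd (Phi f - f x) <= r) -> (bidistE md Phi <= r%:E)%E.
Proof.
move=> h; apply: le_trans ((bidualN_leP (Phi - canJ x) r).2 h).
by apply: ereal_inf_lbound; exists (canJ x) => //; exists x.
Qed.

Lemma bidist_ge Phi (r : R) :
  (forall x, exists2 f, ballXs md f & r <= smd (Phi f - f x)) ->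
  (r%:E <= bidistE md Phi)%E.
Proof.
move=> h; apply: le_ereal_inf_tmp => _ [_ [x _ <-] <-].
have [f f1 fr] := h x; apply: (@le_trans _ _ (smd (Phi f - f x))%:E).
  by rewrite lee_fin.
by apply: ereal_sup_ubound; exists f.
Qed.

(** If [Phi] were farther than [r + e] from all points of [C], each point would be detected by a
    functional of the unit ball. Finitely many of these suffice by weak compactness; some [a] in [A]
    agrees with [Phi] on them up to [e], and a point of [C] within [r] of [a] then escapes
    detection. *)
Lemma bidist_le_omega (A : set E) Phi :
  wstar_closure md setT (@nrm _ _ md E) A Phi ->
  (bidistE md Phi <= omega md setT (@nrm _ _ md E) A)%E.
Proof.
move=> [_ PhiA]; apply: le_ereal_inf_tmp => _ [C [[Cw Ccov] _] <-].
apply: le_ereal_upper => r Ar.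
have AC a : A a -> exists2 c, C c & fnorm (a - c) < r.
  move=> Aa; have : (vdist (@nrm _ _ md E) a C < r%:E)%E.
    by apply: le_lt_trans Ar; apply: ereal_sup_ubound; exists a.
  by move=> /ereal_inf_lt[_ [c Cc <-]]; rewrite lte_fin; exists c.
apply/lee_addgt0Pr => e e0; rewrite -EFinD; apply: contrapT => hbd.
have [|x Cx|J [fJ CJ]] := Ccov _
    (fun f => [set x | ballXs md f /\ setT x /\ r + e < smd (Phi f - f x)]).
(* The cover is indexed by all [f]; outside the dual ball the corresponding set is empty. *)
- move=> f; have [f1|nf] := pselect (ballXs md f); last by split=> [x []//|x []].
  have := @weak_open_ball _ _ _ setT (@nrm _ _ md E) f (Phi f) (r + e) f1.1.
  by congr (weak_open _ _ _ _); apply/seteqP; split=> x //= [].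
- apply: contrapT => nU; apply: hbd; apply: (@bidist_le _ x) => f f1.
  by rewrite leNgt; apply/negP => rf; apply: nU; exists f.
have [||a [Aa af]] := PhiA (J `&` @ballXs _ _ md E) _ _ e e0.
- by move=> f [_ []].
- exact: finite_setIl.
have [c Cc ac] := AC _ Aa.
have [f Jf [f1 [_ fc]]] := CJ _ Cc.
have := af f (conj Jf f1); have := ((ballXsP f).1 f1).2 (a - c).
rewrite (linformB ((ballXsP f).1 f1).1).
have := smd_distD (f a) (Phi f) (f c); lra.
Qed.

Lemma wstar_lim_closure (y : nat -> E) Phi :
  wstar_lim md y Phi -> wstar_closure md setT (@nrm _ _ md E) (range y) Phi.
Proof.
move=> [dPhi yPhi]; split=> // F FD fF e e0.
have [n0 hn] := @finite_eventually _ F (fun f n => smd (f (y n) - Phi f) < e) fF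
  (fun f Ff => yPhi f (FD f Ff) e e0).
exists (y n0); split; first by exists n0.
by move=> f Ff; rewrite smd_distC hn.
Qed.

End Dual.

(** * Measures of noncompactness of sequences *)

Lemma le_ereal_upperM (R : realType) (c : R) (x y : \bar R) : 0 < c ->
  (forall r : R, (x < r%:E)%E -> (y <= (c * r)%:E)%E) -> (y <= c%:E * x)%E.
Proof.
move=> c0 h; apply: le_ereal_upper => r.
rewrite -lte_pdivlMl// -EFinM => /h.
by rewrite mulrA divff ?gt_eqF// mul1r.
Qed.

Section Sequences.
Variables (R : realType) (sc : scalar_kind) (E : normedModType (scal R sc)).
Local Notation md := (@smd R sc).
Local Notation nrmE := (@nrm _ _ md E).

Lemma dualB (f g : E -> (scal R sc)^o) : dual md f -> dual md g -> dual md (f - g).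
Proof.
move=> /dualP[fL [c fc]] /dualP[gL [d gd]]; apply/dualP; split=> [a u v|].
  by rewrite !fctE fL gL mulrBr addrACA opprD.
exists (c + d) => u; rewrite !fctE mulrDl.
by rewrite (le_trans (smdD _ _))// lerD// smdN.
Qed.

Lemma rho_weakly_cauchy (x : nat -> E) : rho_cauchy md x -> weakly_cauchy md x.
Proof.
move=> xr f df e e0; have [||n0 n0P] := xr [set f] _ (e / 2).
- by apply: weak_compact_finite; [move=> _ ->|exact: finite_set1].
- by rewrite divr_gt0.
exists n0 => n m n0n n0m; have := n0P n m n0n n0m f erefl; lra.
Qed.

Lemma ca_le (y : nat -> E) n (r : R) :
  (forall k l, (n <= k)%N -> (n <= l)%N -> fnorm (y k - y l) <= r) ->
  (ca nrmE y <= r%:E)%E.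
Proof.
move=> h; apply: (@le_trans _ _ (ereal_sup [set nrmE (y k.1 - y k.2)%R
    | k in [set k : nat * nat | (n <= k.1)%N /\ (n <= k.2)%N]])).
  by apply: ereal_inf_lbound; exists n.
by apply: ge_ereal_sup => _ [[k l] /= [nk nl] <-]; rewrite lee_fin; exact: h.
Qed.

Lemma ca_gt (y : nat -> E) (r : R) : (r%:E < ca nrmE y)%E ->
  forall n, exists k l, [/\ (n <= k)%N, (n <= l)%N & r < fnorm (y k - y l)].
Proof.
move=> rc n; apply: contrapT => nkl; move: rc; rewrite ltNge; apply/negP; rewrite negbK.
apply: (@ca_le _ n) => k l nk nl; rewrite leNgt; apply/negP => rkl.
by apply: nkl; exists k, l.
Qed.

(** The first [n.+1] terms form a finite, hence weakly compact, set, and every later term is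
    compared with [y n]. *)
Lemma omega_range_le_ca (y : nat -> E) :
  (omega md setT nrmE (range y) <= ca nrmE y)%E.
Proof.
apply: le_ereal_inf_tmp => _ [n _ <-]; set S := ereal_sup _.
have SP k l : (n <= k)%N -> (n <= l)%N -> (nrmE (y k - y l)%R <= S)%E.
  by move=> nk nl; apply: ereal_sup_ubound; exists (k, l).
pose C := y @` `I_n.+1.
apply: (@le_trans _ _ (ereal_sup [set vdist nrmE a C | a in range y])).
  apply: ereal_inf_lbound; exists C => //; split; last by exists (y n); exists n => /=.
  by apply: weak_compact_finite => //; apply: finite_image; exact: finite_II.
apply: ge_ereal_sup => _ [_ [k _ <-] <-]; have [kn|nk] := leqP k n.
  apply: (@le_trans _ _ (nrmE (y k - y k))).
    by apply: ereal_inf_lbound; exists (y k) => //; exists k.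
  (* The supremum [S] is non-negative because it includes the pair [(n, n)]. *)
  by rewrite subrr -(subrr (y n)) SP.
apply: (@le_trans _ _ (nrmE (y k - y n))); last by rewrite SP// ltnW.
by apply: ereal_inf_lbound; exists (y n) => //; exists n => /=.
Qed.

Lemma omega_subset (A B : set E) : A `<=` B ->
  (omega md setT nrmE A <= omega md setT nrmE B)%E.
Proof.
move=> AB; apply: le_ereal_inf_tmp => _ [C Cwc <-].
apply: (@le_trans _ _ (ereal_sup [set vdist nrmE a C | a in A])).
  by apply: ereal_inf_lbound; exists C.
by apply: ereal_sup_le => _ [a Aa <-]; exists a => //; exact: AB.
Qed.

Lemma omega_le_chi (A : set E) : (omega md setT nrmE A <= chi setT nrmE A)%E.
Proof.
apply: ereal_inf_le_tmp => _ [F [_ fF F0] <-]; exists F => //; split=> //.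
exact: weak_compact_finite.
Qed.

(* Beyond some index every term lies near a centre which is approached
   infinitely often; by weak convergence two such centres are [2r]-close. *)
Lemma ca_le_chi (A : set E) (y : nat -> E) : weakly_cauchy md y ->
  (forall n, A (y n)) -> (ca nrmE y <= 4%:E * chi setT nrmE A)%E.
Proof.
move=> yw yA; apply: le_ereal_upperM => // r /ereal_inf_lt[_ [F [_ fF _] <-] Fr].
have near n : exists2 c, F c & fnorm (y n - c) < r.
  have : (vdist nrmE (y n) F < r%:E)%E.
    by apply: le_lt_trans Fr; apply: ereal_sup_ubound; exists (y n).
  by move=> /ereal_inf_lt[_ [c Fc <-]]; rewrite lte_fin; exists c.
pose freq c := forall m, exists2 k, (m <= k)%N & fnorm (y k - c) < r.
have [|n0 hn0] := @finite_eventually _ F (fun c n => fnorm (y n - c) < r -> freq c) fF.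
- move=> c Fc; have [fc|nfc] := pselect (freq c); first by exists 0%N.
  have [m hm] : exists m, forall k, (m <= k)%N -> ~ fnorm (y k - c) < r.
    apply: contrapT => nm; apply: nfc => m; apply: contrapT => nk.
    by apply: nm; exists m => k mk kc; apply: nk; exists k.
  by exists m => n /hm.
apply: (@ca_le _ n0) => k l n0k n0l.
have [c Fc kc] := near k; have [d Fd ld] := near l.
(* For each [f] of the dual ball, late terms near [c] and near [d] have almost equal values under
   [f]. The total 4 is [r] from [y k] to [c], [2 * r] from [c] to [d], and [r] from [d] to [y l]. *)
have cd : fnorm (c - d) <= 2 * r.
  apply: fnorm_le_dual => f f1; have [fL fn] := (ballXsP f).1 f1.
  rewrite (linformB fL); apply/ler_addgt0Pr => e e0.
  have [m hm] := yw f f1.1 e e0.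
  have [i mi ic] := hn0 _ n0k _ Fc kc m; have [j mj jd] := hn0 _ n0l _ Fd ld m.
  have := fn (y i - c); have := fn (y j - d); rewrite !(linformB fL).
  have := smd_distD (f (y i)) (f c) (f d); have := smd_distD (f (y j)) (f (y i)) (f d).
  have := hm i j mi mj; rewrite [smd (f c - f (y i))]smd_distC; lra.
have := fnorm_distD c (y k) (y l); have := fnorm_distD d c (y l).
rewrite [fnorm (d - y l)]fnorm_distC; lra.
Qed.

End Sequences.

(** * Bounded operators and adjoints *)

Section Operator.
Variables (R : realType) (sc : scalar_kind) (X Y : normedModType (scal R sc)).
Local Notation md := (@smd R sc).
Variable T : {linear X -> Y}.
Hypothesis hT : continuous T.

Lemma operator_bound : exists M : R, 0 < M /\ forall x, fnorm (T x) <= M * fnorm x.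
Proof.
have /linear_boundedP [m [mr hm]] := continuous_linear_bounded (0 : X) (hT (x := 0)).
exists (smd m + 1); split; first by rewrite ltr_wpDl ?smd_ge0.
move=> x; rewrite -(le_emb sc) embM -!fnorm_emb; apply: hm.
by rewrite (le_lt_trans (real_ler_norm mr))// norm_emb embD emb1 ltrDl.
Qed.

Lemma dual_comp (f : Y -> (scal R sc)^o) : dual md f -> dual md (f \o T).
Proof.
move=> df; have [c [c0 _ fc]] := dnormP df; have [M [M0 TM]] := operator_bound.
apply/dualP; split=> [a u v|]; first by rewrite /= linearP (dual_linear df).
by exists (c * M) => u; rewrite (le_trans (fc _))// -mulrA ler_wpM2l.
Qed.

Lemma weakly_cauchy_comp (x : nat -> X) : weakly_cauchy md x -> weakly_cauchy md (T \o x).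
Proof. by move=> xw f df; exact: (xw _ (dual_comp df)). Qed.

(** Each [f \o T] is within [r] of some [c] in the weakly compact set [C], on which the differences
    [x k - x l] are uniformly small. The factor 2 bounds the norm of [x k - x l]. *)
Lemma ca_le_omega_adjoint (x : nat -> X) : rho_cauchy md x ->
  (forall n, ballX md (x n)) ->
  (ca (@nrm _ _ md Y) (T \o x) <= 2%:E * omegaTs md T)%E.
Proof.
move=> xr x1; apply: le_ereal_upperM => // r /ereal_inf_lt[_ [C [Cw _] <-] Cr].
apply/lee_addgt0Pr => e e0; rewrite -EFinD.
have [n0 n0P] := xr C Cw e e0; apply: (@ca_le _ _ _ _ n0) => k l n0k n0l.
apply: fnorm_le_dual => f f1 /=; rewrite -linearB.
have : (vdist (@dnorm _ _ md X) (f \o T) C < r%:E)%E.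
  apply: le_lt_trans Cr; apply: ereal_sup_ubound.
  by exists (f \o T) => //; exists f.
move=> /ereal_inf_lt[_ [c Cc <-]] /ltW.
have dc := Cw.1 _ Cc; have dfc := dualB (dual_comp f1.1) dc.
move=> /(dnorm_leP _ dfc)[r0 fcr].
have xkl : fnorm (x k - x l) <= 2.
  rewrite (le_trans (fnormD _ _))// fnormN -[2]/(1 + 1) lerD//; exact: x1.
have := ler_wpM2l r0 xkl; have := fcr (x k - x l).
have := n0P k l n0k n0l c Cc; rewrite -(linformB (dual_linear dc)) !fctE /=.
have := smd_distD (c (x k - x l)) (f (T (x k - x l))) 0; rewrite !subr0; lra.
Qed.

End Operator.

(** * Weakly unconditionally Cauchy series *)

Section WUC.
Variables (R : realType) (sc : scalar_kind) (E : normedModType (scal R sc)).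
Local Notation md := (@smd R sc).
Local Notation psum z n := (\sum_(0 <= i < n) z i).
Implicit Types (z : nat -> E) (f g : E -> (scal R sc)^o).

(** A weakly unconditionally Cauchy series with constant 1. Partial sums keep the condition in [R];
    [wuc_nneseries] links it to the condition in [ucT]. *)
Definition wuc z :=
  forall f, ballXs md f -> forall n, \sum_(0 <= i < n) smd (f (z i)) <= 1.

Lemma wuc_dual z f (c : R) : wuc z -> dual md f -> 0 <= c ->
  (forall u, smd (f u) <= c * fnorm u) -> forall n, \sum_(0 <= i < n) smd (f (z i)) <= c.
Proof.
(* Dividing [f] by [c + e] rather than [c] covers the case [c = 0]. *)
move=> zw df c0 fc n; apply/ler_addgt0Pr => e e0.
have ce : 0 < c + e by rewrite ltr_wpDl.
have ceV : smd (emb sc (c + e)^-1) = (c + e)^-1 by rewrite smd_emb// invr_ge0 ltW.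
have /zw /(_ n) : ballXs md (fun u => emb sc (c + e)^-1 * f u).
  apply/ballXsP; split=> [a u v|u].
    by rewrite (dual_linear df) mulrDr mulrCA.
  rewrite smdM ceV ler_pdivrMl// (le_trans (fc u))// ler_wpM2r ?fnorm_ge0//.
  by rewrite lerDl ltW.
under eq_bigr do rewrite smdM ceV.
by rewrite -mulr_sumr ler_pdivrMl// mulr1.
Qed.

Lemma wuc_bounded_sums z f : wuc z -> dual md f -> bounded_sums (fun i => smd (f (z i))).
Proof.
by move=> zw df; have [c [c0 _ fc]] := dnormP df; exists c; exact: wuc_dual.
Qed.

Lemma wuc_ball z a b : wuc z -> fnorm (\sum_(a <= i < b) z i) <= 1.
Proof.
move=> zw; apply: fnorm_le_dual => f f1; rewrite (linform_sum (dual_linear f1.1)).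
rewrite (le_trans (smd_sum _ _ _))//; have [ab|ba] := leqP a b; last first.
  by rewrite big_geq ?ler01// ltnW.
apply: le_trans (zw f f1 b); rewrite (@big_cat_nat _ _ _ a 0 b)//= lerDr.
by apply: sumr_ge0 => i _; exact: smd_ge0.
Qed.

Lemma wuc_blocks z (l u : nat -> nat) : wuc z ->
  (forall k, (l k <= u k)%N) -> (forall k, (u k <= l k.+1)%N) ->
  wuc (fun k => \sum_(l k <= i < u k) z i).
Proof.
move=> zw lu ul f f1 n; apply: le_trans (zw f f1 (l n)).
apply: le_trans (@sum_blocks _ (fun i => smd (f (z i))) l u n _ lu ul) => [|i].
  by apply: ler_sum => k _; rewrite (linform_sum (dual_linear f1.1)) smd_sum.
exact: smd_ge0.
Qed.

Lemma wuc_subseq z (s : nat -> nat) : wuc z -> (forall j, (s j < s j.+1)%N) ->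
  wuc (z \o s).
Proof.
move=> zw sS f f1 n; apply: le_trans (zw f f1 (s n)).
have F0 i : 0 <= smd (f (z i)) by exact: smd_ge0.
apply: le_trans (sum_increasing 0 n F0 sS) _.
rewrite (@big_cat_nat _ _ _ (s 0%N) 0 (s n))//= ?lerDr ?sumr_ge0//.
exact: leq_increasing.
Qed.

(** On each functional the series converges absolutely. The limit is a bounded form on the dual,
    because the partial sums stay in the unit ball. *)
Lemma wuc_weak_limit z : wuc z -> exists Phi : (E -> (scal R sc)^o) -> (scal R sc)^o,
  bidualD md setT (@nrm _ _ md E) Phi /\
  forall f, dual md f -> forall e : R, 0 < e ->
    exists n0, forall n, (n0 <= n)%N -> smd (f (psum z n) - Phi f) < e.
Proof.
move=> zw.
have /choice[Phi PhiP] f : exists l : (scal R sc)^o, dual md f -> forall e : R, 0 < e ->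
    exists n0, forall n, (n0 <= n)%N -> smd (f (psum z n) - l) < e.
  (* [Phi] takes the default value 0 outside the dual. *)
  have [df|ndf] := pselect (dual md f); last by exists 0.
  have [|l lP] := @cauchy_limit R sc (fun n => f (psum z n)); last by exists l.
  move=> e e0.
  have [N hN] := bounded_sums_tail (fun i => smd_ge0 _) (wuc_bounded_sums zw df) e0.
  have main n m : (N <= n)%N -> (n <= m)%N -> smd (f (psum z m) - f (psum z n)) <= e.
    move=> Nn nm; rewrite -(linformB (dual_linear df)).
    rewrite (@big_cat_nat _ _ _ n 0 m)//= addrAC subrr add0r.
    by rewrite (linform_sum (dual_linear df)) (le_trans (smd_sum _ _ _))// hN.
  exists N => n m Nn Nm; have [nm|/ltnW mn] := leqP n m.
    by rewrite smd_distC main.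
  by rewrite main.
exists Phi; split=> //; split=> [a f g df dg|].
  have dfg : dual md (a *: f + g).
    have [fL [c fc]] := (dualP f).1 df; have [gL [d gd]] := (dualP g).1 dg.
    apply/dualP; split=> [b u v|].
      by rewrite !fctE fL gL scalerDr scalerA mulrC -scalerA addrACA -scalerDr.
    exists (smd a * c + d) => u; rewrite !fctE (le_trans (smdD _ _))// mulrDl lerD//.
    by rewrite /GRing.scale/= smdM -mulrA ler_wpM2l ?smd_ge0.
  apply: linear_limit => e e0.
  have [n1 h1] := PhiP _ dfg _ e0; have [n2 h2] := PhiP _ df _ e0.
  have [n3 h3] := PhiP _ dg _ e0; pose n := maxn n1 (maxn n2 n3).
  exists (f (psum z n)), (g (psum z n)); split.
  - by apply: h1; rewrite leq_maxl.
  - by apply: h2; rewrite !leq_max leqnn orbT.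
  - by apply: h3; rewrite !leq_max leqnn !orbT.
exists 1 => f df; have [c [c0 fE fc]] := dnormP df.
rewrite -/(dnorm md f) fE mul1e lee_fin; apply/ler_addgt0Pr => e e0.
have [n0 h] := PhiP _ df _ e0.
have := h _ (leqnn _); have := fc (psum z n0); have := wuc_ball 0 n0 zw => k1 k2 k3.
have := ler_piMr c0 k1; have := smd_distB (Phi f) (f (psum z n0)).
rewrite smd_distC; lra.
Qed.

(** The gliding hump with [e = r / 8] leaves at most [r / 8] on either side of a diagonal entry
    larger than [r]: partial sums that stop before the diagonal stay small, and those that pass it
    lose at most [r / 4]. *)
Lemma gliding_hump_wuc z (h : nat -> E -> (scal R sc)^o) g (r : R) : 0 < r ->
  wuc z -> (forall k, dual md (h k)) -> (forall k, r < smd (h k (z k))) -> dual md g ->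
  (forall N m (e : R), 0 < e -> exists k, (m <= k)%N /\
     forall i, (i < N)%N -> smd (h k (z i) - g (z i)) < e) ->
  exists s : nat -> nat, [/\ forall j, (s j < s j.+1)%N,
    forall j n, (n <= j)%N -> smd (h (s j) (psum (z \o s) n)) <= r / 4 &
    forall j n, (j < n)%N -> 3 * r / 4 <= smd (h (s j) (psum (z \o s) n))].
Proof.
move=> r0 zw dh hz dg clus.
have [||||||s [sS s1 s2]] := @gliding_hump R (fun k i => smd (h k (z i)))
    (fun i => smd (g (z i))) (r / 8).
- by move=> k i; exact: smd_ge0.
- by move=> k; exact: wuc_bounded_sums.
- by move=> i; exact: smd_ge0.
- exact: wuc_bounded_sums.
- by rewrite divr_gt0.
- move=> N m d d0; have [k [mk hk]] := clus N m d d0; exists k; split=> // i iN.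
  have := hk i iN; have := smd_distB (h k (z i)) (g (z i)); lra.
exists s; split=> // j n jn.
  rewrite (linform_sum (dual_linear (dh _))) (le_trans (smd_sum _ _ _))//.
  by rewrite (le_trans (s1 j n jn))// ler_pM2l// lef_pV2 ?posrE// ler_nat.
rewrite (linform_sum (dual_linear (dh _))) (@big_cat_nat _ _ _ j 0 n)//=;
  last exact: ltnW.
rewrite [X in _ + X]big_ltn//.
have := s1 j j (leqnn _); have := s2 j n; have := hz (s j).
have := smd_sum (index_iota 0 j) xpredT (fun i => h (s j) (z (s i))).
have := smd_sum (index_iota j.+1 n) xpredT (fun i => h (s j) (z (s i))).
set A := \sum_(0 <= i < j) _; set B := \sum_(j.+1 <= i < n) h _ _.
have := smd_distB (h (s j) (z (s j))) (- (A + B)).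
rewrite opprK smdN addrCA; have := smdD A B; lra.
Qed.

(** Both bounds survive the limit in [n]. For [g'], a fixed partial sum is tested with a later
    [h (s j)], whose value there is at most [r / 4]. [Phi] and [g'] are quantified after [s] because
    they are obtained from the subsequence. *)
Lemma hump_limit z (h : nat -> E -> (scal R sc)^o) g (r : R) : 0 < r ->
  wuc z -> (forall k, dual md (h k)) -> (forall k, r < smd (h k (z k))) -> dual md g ->
  (forall N m (e : R), 0 < e -> exists k, (m <= k)%N /\
     forall i, (i < N)%N -> smd (h k (z i) - g (z i)) < e) ->
  exists s : nat -> nat, (forall j, (s j < s j.+1)%N) /\
  forall Phi : (E -> (scal R sc)^o) -> (scal R sc)^o,
    (forall f, dual md f -> forall e : R, 0 < e ->
       exists n0, forall n, (n0 <= n)%N -> smd (f (psum (z \o s) n) - Phi f) < e) ->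
    (forall j, 3 * r / 4 <= smd (Phi (h (s j)))) /\
    forall g', dual md g' ->
      (forall n m (e : R), 0 < e -> exists j, (m <= j)%N /\
        smd (h (s j) (psum (z \o s) n) - g' (psum (z \o s) n)) < e) ->
      smd (Phi g') <= r / 4.
Proof.
move=> r0 zw dh hz dg clus; have [s [sS s1 s2]] := gliding_hump_wuc r0 zw dh hz dg clus.
exists s; split=> // Phi PhiP; split=> [j|g' dg' clus'].
  apply/ler_addgt0Pr => e e0; have [n0 hn0] := PhiP _ (dh (s j)) _ e0.
  have := hn0 (maxn n0 j.+1) (leq_maxl _ _); have := s2 j (maxn n0 j.+1) (leq_maxr _ _).
  set S := psum _ _; have := smd_distB (h (s j) S) (Phi (h (s j))); lra.
apply/ler_addgt0Pr => e e0; have e20 : 0 < e / 2 by rewrite divr_gt0.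
have [n hn] := PhiP _ dg' _ e20; have := hn _ (leqnn n).
have [j [nj hj]] := clus' n n _ e20; have := s1 j n nj; move: hj.
set S := psum _ _; have := smd_distB (Phi g') (g' S).
rewrite (smd_distC (Phi g')).
have := smd_distB (g' S) (h (s j) S); rewrite (smd_distC (g' S) (h _ _)); lra.
Qed.

End WUC.

(** A failure on [C] yields disjoint blocks on which functionals [h k] of [C] exceed [e]. The limit
    [Phi] of the thinned block sums then takes values at least [3 * e / 4] along [h \o s] but at
    most [e / 4] at a cluster point of it, which the weak topology of the dual excludes. *)
Lemma wuc_rho_cauchy (R : realType) (sc : scalar_kind) (E : normedModType (scal R sc))
  (z : nat -> E) : wuc z -> rho_cauchy (@smd R sc) (fun n => \sum_(0 <= i < n) z i).
Proof.
move=> zw C Cw e e0; apply: contrapT => nC.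
have Cd f : C f -> dual (@smd R sc) f by exact: Cw.1.
have [N|l [u [lu ul hlu]]] := @disjoint_blocks
    (fun l u => exists2 f, C f & e < smd (f (\sum_(l <= i < u) z i))).
  apply: contrapT => nlu; apply: nC; exists N => n m Nn Nm f Cf.
  have main a b : (N <= a)%N -> (a <= b)%N ->
      smd (f (\sum_(0 <= i < b) z i) - f (\sum_(0 <= i < a) z i)) <= e.
    move=> Na ab; rewrite -(linformB (dual_linear (Cd _ Cf))).
    rewrite (@big_cat_nat _ _ _ a 0 b)//= addrAC subrr add0r leNgt; apply/negP => ez.
    by apply: nlu; exists a, b; split=> //; exists f.
  have [nm|/ltnW mn] := leqP n m; last exact: main.
  by rewrite smd_distC main.
have /choice[h hP] k : exists f, C f /\ e < smd (f (\sum_(l k <= i < u k) z i)).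
  by have [f Cf fz] := hlu k; exists f.
have Ch k : C (h k) by case: (hP k).
have zw' := wuc_blocks zw lu ul.
have [g [Cg gcl]] := weak_compact_cluster Cw Ch.
have [|N m d d0|s [sS sP]] := hump_limit e0 zw' (fun k => Cd _ (Ch k)) _ (Cd _ Cg).
- by move=> k; case: (hP k).
- have [||k [mk hk]] := gcl [set canJ (\sum_(l i <= j < u i) z j) | i in `I_N] _ _ d m d0.
  + by move=> _ [i _ <-]; exact: canJ_bidual.
  + by apply: finite_image; exact: finite_II.
  by exists k; split=> // i iN; apply: (hk (canJ _)); exists i.
have [Phi [dPhi PhiP]] := wuc_weak_limit (wuc_subseq zw' sS).
have [Phih Phig] := sP _ PhiP.
(* A second cluster point is taken, now along the subsequence. Evaluations at partial sums give the
   bound on [Phi g']; [Phi] itself, as a test functional, gives the contradiction. *)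
have [g' [Cg' gcl']] := weak_compact_cluster Cw (fun j => Ch (s j)).
have e40 : 0 < e / 4 by rewrite divr_gt0.
have g'4 : smd (Phi g') <= e / 4.
  apply: Phig (Cd _ Cg') _ => n m d d0.
  have [||j [mj hj]] := gcl' [set canJ (\sum_(0 <= i < n)
      ((fun k => \sum_(l k <= i < u k) z i) \o s) i)] _ _ d m d0.
  + by move=> _ ->; exact: canJ_bidual.
  + exact: finite_set1.
  by exists j; split=> //; exact: (hj _ erefl).
have [||j [_ hj]] := gcl' [set Phi] _ _ (e / 4) 0%N e40.
- by move=> _ ->.
- exact: finite_set1.
have := hj _ erefl; have := Phih j; have := smd_distB (Phi (h (s j))) (Phi g'); lra.
Qed.

(* Banach-Alaoglu along an ultrafilter. *)
Lemma dual_ball_cluster (R : realType) (sc : scalar_kind) (E : normedModType (scal R sc))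
  (g : nat -> E -> (scal R sc)^o) : (forall k, ballXs (@smd R sc) (g k)) ->
  exists h, ballXs (@smd R sc) h /\
    forall (y : nat -> E) N m (e : R), 0 < e -> exists k, (m <= k)%N /\
      forall i, (i < N)%N -> smd (g k (y i) - h (y i)) < e.
Proof.
move=> g1; have gL k := ((ballXsP _).1 (g1 k)).1; have gn k := ((ballXsP _).1 (g1 k)).2.
have [U [UU oU]] := ultraFilterLemma eventually_filter.
have tail m : U [set n | (m <= n)%N] by apply: oU; exists m.
have /choice[h hP] y : exists l : (scal R sc)^o, forall e : R, 0 < e ->
    U [set k | smd (g k y - l) < e].
  exact: (@ultra_limit R sc U (fun k => g k y) (fnorm y) UU (fun k => gn k y)).
exists h; split.
  apply/ballXsP; split=> [a u v|u].
    apply: linear_limit => e e0.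
    have [k /= [k1 [k2 k3]]] := filter_ex (filterI (hP (a *: u + v) _ e0)
      (filterI (hP u _ e0) (hP v _ e0))).
    by exists (g k u), (g k v); rewrite -gL.
  apply/ler_addgt0Pr => e e0; have [k /= ku] := filter_ex (hP u _ e0).
  have := gn k u; have := smd_distB (h u) (g k u); rewrite smd_distC; lra.
move=> y N m e e0.
have UN : U [set k | forall i, (i < N)%N -> smd (g k (y i) - h (y i)) < e].
  elim: N => [|N IH]; first by apply: filterS (tail 0%N).
  apply: filterS (filterI IH (hP (y N) _ e0)) => k /= [kN kyN] i.
  by rewrite ltnS leq_eqVlt => /predU1P[->|/kN].
by have [k [mk kN]] := filter_ex (filterI (tail m) UN); exists k.
Qed.

(** * Comparison of uc and Rcc *)

Section Uc.
Variables (R : realType) (sc : scalar_kind) (X Y : normedModType (scal R sc)).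
Local Notation md := (@smd R sc).
Variable T : {linear X -> Y}.
Hypothesis hT : continuous T.

(** The functional in the conclusion is the second adjoint of [T] at [Phi]; it is bounded because
    composing with [T] multiplies dual norms by at most [M]. *)
Lemma bidual_adjoint (Phi : (X -> (scal R sc)^o) -> (scal R sc)^o) :
  bidualD md setT (@nrm _ _ md X) Phi ->
  bidualD md setT (@nrm _ _ md Y) (fun f => Phi (f \o T)).
Proof.
move=> [PhiL [C PhiC]]; have [M [M0 TM]] := operator_bound hT; split=> [a f g df dg|].
  exact: (PhiL a (f \o T) (g \o T) (dual_comp hT df) (dual_comp hT dg)).
exists (`|C| * M) => f df; have dfT := dual_comp hT df.
have [c [c0 fE fc]] := dnormP df; have [d [d0 fTE _]] := dnormP dfT.
have := PhiC _ dfT; rewrite -!/(dnorm md _) fE fTE -!EFinM !lee_fin => /le_trans; apply.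
have dcM : d <= M * c.
  rewrite -lee_fin -fTE; apply/(dnorm_leP _ dfT) => //; split=> [|u].
    by rewrite mulr_ge0 ?(ltW M0).
  by rewrite /= (le_trans (fc _))// mulrAC [leRHS]mulrC ler_wpM2l.
rewrite (@le_trans _ _ (`|C| * d))//; first by rewrite ler_wpM2r// ler_norm.
by rewrite -mulrA ler_wpM2l.
Qed.

Lemma Rcc_ge (x : nat -> X) (r : R) : 0 < r -> wuc x ->
  (r%:E < ca (@nrm _ _ md Y) (fun n => (\sum_(i < n.+1) T (x i))%R))%E ->
  ((r / 4)%:E <= RccT md T)%E.
Proof.
move=> r0 xw rca.
have [N|l [u [lu ul hlu]]] := @disjoint_blocks
    (fun l u => r < fnorm (T (\sum_(l <= i < u) x i))).
  have main a b : (N <= a)%N -> (a <= b)%N ->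
      r < fnorm (\sum_(i < b) T (x i) - \sum_(i < a) T (x i)) ->
      exists l u, [/\ (N <= l)%N, (l <= u)%N & r < fnorm (T (\sum_(l <= i < u) x i))].
    move=> Na ab; rewrite -!(big_mkord xpredT (fun i => T (x i))).
    rewrite (@big_cat_nat _ _ _ a 0 b)//= addrAC subrr add0r -raddf_sum.
    by exists a, b.
  (* The partial sums in [ucT] include the term of index [n], so [main] is used at [k.+1] and
     [l.+1]. *)
  have [k [l [Nk Nl]]] := ca_gt rca N; have [kl|/ltnW lk] := leqP k l.
    by rewrite fnorm_distC; apply: main => //; exact: leq_trans Nk _.
  by apply: main => //; exact: leq_trans Nl _.
pose z k := \sum_(l k <= i < u k) x i; have zw : wuc z := wuc_blocks xw lu ul.
have /choice[g gP] k : exists f, ballXs md f /\ smd (f (T (z k))) = fnorm (T (z k)).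
  by have [f f1 fz] := norming (T (z k)); exists f.
have g1 k : ballXs md (g k) by case: (gP k).
have dgT k : dual md (g k \o T) := dual_comp hT (g1 k).1.
have [G [G1 Gcl]] := dual_ball_cluster g1.
have [|s [sS sP]] := hump_limit r0 zw dgT _ (dual_comp hT G1.1) (Gcl (T \o z)).
  by move=> k; rewrite /= (gP k).2; exact: hlu.
have zsw := wuc_subseq zw sS.
have [Phi [dPhi PhiP]] := wuc_weak_limit zsw.
have [Phig PhiG] := sP _ PhiP.
(* The first cluster point [G] served to select [s]; [H] clusters along the selected functionals. *)
have [H [H1 Hcl]] := dual_ball_cluster (fun j => g1 (s j)).
have H4 : smd (Phi (H \o T)) <= r / 4.
  apply: PhiG (dual_comp hT H1.1) _ => n m e e0.
  have [j [mj hj]] := Hcl (fun=> T (\sum_(0 <= i < n) (z \o s) i)) 1%N m e e0.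
  by exists j; split=> //; exact: (hj 0%N).
apply: (@le_trans _ _ (bidistE md (fun f => Phi (f \o T)))).
  apply: bidist_ge => y; apply: contrapT => ny.
  have lt4 f : ballXs md f -> smd (Phi (f \o T) - f y) < r / 4.
    by move=> f1; rewrite ltNge; apply/negP => f4; apply: ny; exists f.
  (* With this slack between [g (s j) y] and [H y], the value of [Phi] at [g (s j) \o T] is less
     than three times [r / 4], against the lower bound [Phig]. *)
  have d0 : 0 < r / 4 - smd (Phi (H \o T) - H y) by rewrite subr_gt0 lt4.
  have [j [_ /(_ 0%N isT) hj]] := Hcl (fun=> y) 1%N 0%N _ d0.
  have := lt4 _ (g1 (s j)); have := Phig j.
  have := smd_distB (Phi (g (s j) \o T)) (g (s j) y).
  have := smd_distB (g (s j) y) (H y).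
  have := smd_distB (H y) (Phi (H \o T)); rewrite (smd_distC (H y)); lra.
apply: ereal_sup_ubound; exists (fun f => Phi (f \o T)) => //.
exists (fun n => \sum_(0 <= i < n) (z \o s) i); split.
- exact: wuc_rho_cauchy.
- by move=> n; exact: wuc_ball.
- by split; [exact: bidual_adjoint|move=> f df; exact: (PhiP _ (dual_comp hT df))].
Qed.

(** The zero sequence shows that the supremum is not over an empty set; hence every real above
    [RccT] is positive, as [Rcc_ge] demands. *)
Lemma Rcc_ge0 : (0 <= RccT md T)%E.
Proof.
apply: (@le_trans _ _ (bidistE md (canJ (0 : Y)))).
  apply: bidist_ge => x; have [f f1 _] := norming (0 : Y).
  by exists f => //; exact: smd_ge0.
apply: ereal_sup_ubound; exists (canJ 0) => //; exists (fun=> 0); split.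
- by move=> C _ e e0; exists 0%N => n m _ _ f _; rewrite subrr smd0 ltW.
- by move=> n; rewrite /ballX /= -/(fnorm 0) fnorm0 ler01.
- split; first exact: canJ_bidual.
  by move=> f df e e0; exists 0%N => n _; rewrite /= linear0 subrr smd0.
Qed.

Lemma wuc_nneseries (x : nat -> X) :
  (ereal_sup [set \sum_(0 <= n <oo) (md (f (x n)))%:E | f in @ballXs _ _ md X] <= 1)%E ->
  wuc x.
Proof.
move=> x1 f f1 n; rewrite -lee_fin -sumEFin; apply: le_trans x1.
apply: (@le_trans _ _ (\sum_(0 <= n <oo) (md (f (x n)))%:E)%E).
  by apply: nneseries_lim_ge => i _; rewrite lee_fin smd_ge0.
by apply: ereal_sup_ubound; exists f.
Qed.

Lemma uc_le_Rcc : (ucT md T <= 4%:E * RccT md T)%E.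
Proof.
apply: ge_ereal_sup => _ [x /wuc_nneseries xw <-].
apply: le_ereal_upperM => // r Rr.
have r0 : 0 < r by rewrite -lte_fin (le_lt_trans Rcc_ge0).
rewrite leNgt; apply/negP => rca.
have := Rcc_ge (mulr_gt0 (ltr0n R 4) r0) xw rca.
by rewrite mulrAC divff// mul1r leNgt Rr.
Qed.

End Uc.

(** * The inequalities *)

Lemma wstar_closureS (R : realType) (sc : scalar_kind) (E : normedModType (scal R sc))
  (A B : set E) : A `<=` B ->
  wstar_closure (@smd R sc) setT (@nrm _ _ (@smd R sc) E) A `<=`
  wstar_closure (@smd R sc) setT (@nrm _ _ (@smd R sc) E) B.
Proof.
move=> AB Phi [dPhi PhiA]; split=> // F FD fF e e0.
by have [a [Aa aF]] := PhiA F FD fF e e0; exists a; split=> //; exact: AB.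
Qed.

Local Open Scope ereal_scope.

(* Scalars: real (sc = RealScalars, K = R) or complex (sc = ComplexScalars,
   K = R[i]); @smd R sc is the modulus of a scalar. *)
Theorem theorem5p1 (R : realType) (sc : scalar_kind)
    (X Y : completeNormedModType (scal R sc)) (T : {linear X -> Y})
    (hT : continuous T) :
  let md := @smd R sc in
  ((4^-1)%:E * ucT md T <= RccT md T /\
   RccT md T <= wccT md T /\
   wccT md T <= wkT md T /\
   Rcc_omegaT md T <= wcc_omegaT md T /\
   wcc_omegaT md T <= omegaT md T /\
   cc_rhoT md T <= ccT md T /\
   ccT md T <= 4%:E * chiT md T /\
   RccT md T <= Rcc_omegaT md T /\
   Rcc_omegaT md T <= cc_rhoT md T /\
   cc_rhoT md T <= 2%:E * omegaTs md T /\
   wccT md T <= wcc_omegaT md T /\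
   wcc_omegaT md T <= ccT md T /\
   wkT md T <= omegaT md T /\
   omegaT md T <= chiT md T).
Proof.
move=> md.
have TB (x : nat -> X) : (forall n, ballX md (x n)) ->
    range (T \o x) `<=` T @` @ballX _ _ md X.
  by move=> x1 _ [n _ <-]; exists (x n).
split; first by rewrite lee_pdivrMl//; exact: uc_le_Rcc.
split.
  apply: ereal_sup_le; apply: image_subset => Phi [x [/rho_weakly_cauchy xw x1 xP]].
  by exists x.
split.
  apply: ereal_sup_le; apply: image_subset => Phi [x [_ x1 /wstar_lim_closure]].
  exact: wstar_closureS (TB _ x1) _.
split; first by apply: ereal_sup_le; apply: image_subset => x [/rho_weakly_cauchy].
split; first by apply: ge_ereal_sup => _ [x [_ x1] <-]; apply: omega_subset; exact: TB.
split; first by apply: ereal_sup_le; apply: image_subset => x [/rho_weakly_cauchy].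
split.
  apply: ge_ereal_sup => _ [x [xw x1] <-]; apply: ca_le_chi.
    exact: weakly_cauchy_comp.
  by move=> n; apply: TB x1 _ _; exists n.
(* Keeping [P] abstract serves both weakly Cauchy and Right-Cauchy sequences. *)
have dist_le_omega (P : (nat -> X) -> Prop) :
    ereal_sup [set bidistE md Phi | Phi in [set Phi | exists x : nat -> X,
      [/\ P x, forall n, ballX md (x n) & wstar_lim md (T \o x) Phi]]] <=
    ereal_sup [set omega md setT (@nrm _ _ md Y) (range (T \o x))
      | x in [set x | P x /\ forall n, ballX md (x n)]].
  apply: ge_ereal_sup => _ [Phi [x [Px x1 xPhi]] <-].
  apply: le_trans (bidist_le_omega (wstar_lim_closure xPhi)) _.
  by apply: ereal_sup_ubound; exists x.
have omega_le_ca (P : set (nat -> X)) :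
    ereal_sup [set omega md setT (@nrm _ _ md Y) (range (T \o x)) | x in P] <=
    ereal_sup [set ca (@nrm _ _ md Y) (T \o x) | x in P].
  apply: ge_ereal_sup => _ [x Px <-]; apply: le_trans (omega_range_le_ca _) _.
  by apply: ereal_sup_ubound; exists x.
split; first exact: dist_le_omega.
split; first exact: omega_le_ca.
split; first by apply: ge_ereal_sup => _ [x [xr x1] <-]; exact: ca_le_omega_adjoint.
split; first exact: dist_le_omega.
split; first exact: omega_le_ca.
split; first by apply: ge_ereal_sup => _ [Phi PhiP <-]; exact: bidist_le_omega.
exact: omega_le_chi.
Qed.
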